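(* One has $\vartheta_\infty > \delta_0$ for $\delta_0 = 0.775$. In particular, for $A=110$ one already has $\vartheta_A > \delta_0 = 0.775$.
   Context: $[a_1,a_2,\ldots]$ denotes the infinite continued fraction $\cfrac{1}{a_1+\cfrac{1}{a_2+\ddots}}$ with positive integer partial quotients. For an integer $A\ge1$ let $$\mathfrak{C}_A := \{[b_1,1,b_2,1,\ldots] : b_i\in\mathbb{Z},\ 1\le b_i\le A \text{ for all } i\}$$ (every even-indexed partial quotient equals $1$), let $\vartheta_A$ be the Hausdorff dimension of $\mathfrak{C}_A$, let $\mathfrak{C}_\infty := \bigcup_{A=1}^\infty\mathfrak{C}_A$, and let $\vartheta_\infty$ be the Hausdorff dimension of $\mathfrak{C}_\infty$. *)

(* Defs.v *)
From mathcomp Require Import all_boot all_order all_algebra.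
From mathcomp Require Import all_classical all_reals all_analysis.

Set Implicit Arguments.
Unset Strict Implicit.
Unset Printing Implicit Defensive.

Import Order.TTheory GRing.Theory Num.Theory.
Import numFieldNormedType.Exports.

Local Open Scope classical_set_scope.
Local Open Scope ring_scope.

Section HausdorffDimension.
Variable R : realType.
Implicit Types (s d : R) (E U : set R).

(* [set_diam set0] is [-oo]; [gauge] below treats the empty set separately. *)
Definition set_diam U : \bar R :=
  ereal_sup [set `|x - y|%:E | x in U & y in U].

(* The empty set contributes 0 even when [s = 0], so that finite covers, padded
   with empty sets, keep a finite cost in [hausdorff_content]. *)
Definition gauge s U : \bar R :=
  (if U == set0 then 0 else set_diam U `^ s)%E.

Definition hausdorff_content s d E : \bar R :=
  ereal_inf [set (\sum_(0 <= i <oo) gauge s (U i))%E | U in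
    [set U : (set R)^nat |
      E `<=` \bigcup_i U i /\ forall i, (set_diam (U i) <= d%:E)%E]].

(* The limit as [d] tends to [0+] is a supremum, [hausdorff_content s d E]
   being nonincreasing in [d]. *)
Definition hausdorff_measure s E : \bar R :=
  ereal_sup [set hausdorff_content s d E | d in [set d | 0 < d]].

Definition hausdorff_dim E : \bar R :=
  ereal_inf [set s%:E | s in [set s | 0 <= s /\ hausdorff_measure s E = 0%E]].

End HausdorffDimension.

(* Partial quotients are indexed from 0: [a 0] is the first one.  The n-th
   convergent uses the first [n] partial quotients, the 0-th being 0. *)
Fixpoint convergent (R : realType) (a : nat -> nat) (n : nat) : R :=
  if n is m.+1 then ((a 0%N)%:R + convergent R (fun i => a i.+1) m)^-1 else 0.

Definition cfrac (R : realType) (a : nat -> nat) : R :=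
  lim (convergent R a n @[n --> \oo]).

(* b_1, 1, b_2, 1, ... : the 1's sit at the odd 0-based positions. *)
Definition interleave1 (b : nat -> nat) (i : nat) : nat :=
  if odd i then 1%N else b i./2.

Definition frakC (R : realType) (A : nat) : set R :=
  [set cfrac R (interleave1 b) | b in
    [set b : nat -> nat | forall i, (1 <= b i <= A)%N]].

Arguments frakC R A : clear implicits.

Definition frakC_infty (R : realType) : set R :=
  \bigcup_(A in [set A | (1 <= A)%N]) frakC R A.

Arguments frakC_infty R : clear implicits.

Definition vartheta (R : realType) (A : nat) : \bar R :=
  hausdorff_dim (frakC R A).

Definition vartheta_infty (R : realType) : \bar R :=
  hausdorff_dim (frakC_infty R).

(* Main.v *)
From HB Require Import structures.
From Stdlib Require Import NArith.
Require Import Defs.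
From mathcomp Require Import all_boot all_order all_algebra.
From mathcomp Require Import all_classical all_reals all_analysis.
From mathcomp Require Import ring lra zify.

(** Write f_b(x) = 1 / (b + 1 / (1 + x)).  The points of the Cantor set are the
    limits of f_{b_1} o f_{b_2} o ..., and f_b is a fractional linear map of
    determinant 1.  If (q', q) is the bottom row of the matrix of a word, the
    image of the unit interval under the word has length comparable with q^-2, and
    the dimension is half the exponent p at which the sums of q^-p over the words of
    length n neither grow nor decay with n.

    Appending the digit b changes (q', q) into (q' + b q, q' + (b + 1) q).  It is
    enough to find an exponent p > 31/20 and a positive function of (q', q),
    homogeneous of degree -p, which is at most the sum of its values at the 110
    children: this is a mass on the tree of words that grows from a word to its
    children.  The function
      (9 q + 7 q')^-p + 6 (14 q + 2 q')^-p
    does this ([weight_subharmonic]).  The children of a term (j q + (16 - j) q')^-p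
    are again powers of linear forms, so only the ratio q'/q, between 1/2 and 1,
    matters.

    The mass gives the dimension by a mass distribution principle
    ([hausdorff_measure_ge]).  Points whose codings separate after a word
    are at distance at least a constant times q^-2 ([point_separation]), so
    every set U of diameter d meets the Cantor set inside one cylinder of mass
    at most a constant times d^(p/2), up to an arbitrarily small error
    ([covering_cylinder]), and a covering family of cylinders carries at least
    the mass of the root ([tree_mass_le]).

    The numerical margin is small: the dimension for A = 110 is close to 0.77505.
    The inequality is therefore proved at p = 31/20, with the factor 20001/20000 to
    spare, by interval arithmetic on binary integers ([cells_ok]).  The range
    of 16 q'/q is cut into the eight cells [l, l + 1], 8 <= l <= 15.  On a cell all
    functions involved are convex in the ratio; the larger side is bounded below
    by its tangents at the midpoint and the smaller side above by its chord, with an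
    error quadratic in the size of the cell, and the resulting affine inequality is
    checked at the two ends.  The spare factor then pays for raising the exponent
    slightly above 31/20 ([key_inequality_perturbed]), which makes the bound on the
    dimension strict. *)

Set Implicit Arguments.
Unset Strict Implicit.
Unset Printing Implicit Defensive.

Import Order.TTheory GRing.Theory Num.Theory.
Import numFieldNormedType.Exports.

Local Open Scope classical_set_scope.
Local Open Scope ring_scope.

(** * The continued fraction as an iteration of maps *)

(** Two levels of the continued fraction at once: [branch b] is
    x |-> 1 / (b + 1 / (1 + x)).  Its matrix (1, 1; b, b + 1) has determinant 1,
    which makes the difference formula [branch_sub] exact. *)
Definition branch (R : realType) (b : nat) (x : R) : R :=
  (1 + x) / (b.+1%:R + b%:R * x).

Lemma branch_den_ge1 (R : realType) (b : nat) (x : R) :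
  0 <= x -> 1 <= b.+1%:R + b%:R * x.
Proof.
move=> x0; rewrite -natr1.
have := ler0n R b; have : 0 <= b%:R * x by rewrite mulr_ge0.
lra.
Qed.

Lemma branch_itv (R : realType) (b : nat) (x : R) :
  0 <= x <= 1 -> 0 <= branch b.+1 x <= 1.
Proof.
move=> /andP[x0 x1]; have := branch_den_ge1 b.+1 x0; rewrite /branch => D1.
have D0 : 0 < b.+2%:R + b.+1%:R * x by lra.
apply/andP; split; first by rewrite divr_ge0 //; lra.
rewrite ler_pdivrMr // mul1r -[b.+2%:R]natr1.
have b1 : 1 <= b.+1%:R :> R by rewrite ler1n.
have : 0 <= (b.+1%:R - 1) * x by rewrite mulr_ge0 //; lra.
lra.
Qed.

Lemma branch_sub (R : realType) (b : nat) (x y : R) : 0 <= x -> 0 <= y ->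
  branch b x - branch b y =
  (x - y) / ((b.+1%:R + b%:R * x) * (b.+1%:R + b%:R * y)).
Proof.
move=> /(branch_den_ge1 b) + /(branch_den_ge1 b); rewrite /branch -natr1.
by move=> Dx Dy; field; apply/andP; split; apply/eqP; lra.
Qed.

Section ContinuedFraction.
Variable R : realType.
Implicit Types (b : nat -> nat) (n k : nat).

Lemma convergent_interleave1SS b n :
  convergent R (interleave1 b) n.+2 =
  ((b 0)%:R + (1 + convergent R (interleave1 (fun i => b i.+1)) n)^-1)^-1.
Proof.
have -> : interleave1 (fun i => b i.+1) = fun i => interleave1 b i.+2.
  by apply/funext => i; rewrite /interleave1 /= negbK.
by [].
Qed.

(** Reading the digits two by two turns every convergent into a value of
    [branch]; the unit interval is needed for the next level to make sense. *)
Lemma convergent_branch b n :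
  (forall i, (0 < b i)%N) ->
  0 <= convergent R (interleave1 b) n <= 1 /\
  convergent R (interleave1 b) n.+2 =
  branch (b 0) (convergent R (interleave1 (fun i => b i.+1)) n).
Proof.
have stepE (c : nat -> nat) (x : R) :
    0 <= x -> ((c 0)%:R + (1 + x)^-1)^-1 = branch (c 0) x.
  move=> x0; have := branch_den_ge1 (c 0) x0; rewrite /branch -natr1 => D1.
  have x1 : 1 + x != 0 by apply/eqP; lra.
  field; rewrite x1 andbT; apply/eqP; lra.
have itv m : forall c, (forall i, (0 < c i)%N) ->
    0 <= convergent R (interleave1 c) m <= 1.
  elim/ltn_ind: m => -[|[|m]] IH c c0; first by rewrite /= lexx ler01.
    rewrite /= addr0 invr_ge0 ler0n /= invf_le1 ?ler1n ?ltr0n //=; exact: c0.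
  rewrite convergent_interleave1SS.
  have c0' i : (0 < c i.+1)%N by [].
  have /andP[x0 x1] := IH m (leqW (ltnSn m)) _ c0'.
  rewrite stepE //; have := c0 0%N; case: (c 0%N) => // k _.
  by rewrite branch_itv // x0.
move=> b0; split; first exact: itv.
rewrite convergent_interleave1SS stepE //.
by have /andP[] := itv n _ (fun i => b0 i.+1).
Qed.

(** Each [branch] halves distances at least, so convergents that agree on the
    first 2k partial quotients are 2^-k close: the convergents are Cauchy. *)
Lemma convergent_contract k : forall b n m, (forall i, (0 < b i)%N) ->
  `|convergent R (interleave1 b) (k.*2 + n) -
    convergent R (interleave1 b) (k.*2 + m)| <= 2^-1 ^+ k.
Proof.
elim: k => [|k IH] b n m b0.
  rewrite expr0 !add0n ler_norml.
  have [/andP[? ?] _] := convergent_branch n b0.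
  have [/andP[? ?] _] := convergent_branch m b0.
  by apply/andP; split; lra.
rewrite doubleS !addSn.
have [_ ->] := convergent_branch (k.*2 + n) b0.
have [_ ->] := convergent_branch (k.*2 + m) b0.
have b1 i : (0 < b i.+1)%N by [].
have := IH (fun i => b i.+1) n m b1.
have [/andP[+ _] _] := convergent_branch (k.*2 + n) b1.
have [/andP[+ _] _] := convergent_branch (k.*2 + m) b1.
move: (convergent _ _ _) (convergent _ _ (_ + n)%N) => y x y0 x0 xy.
rewrite branch_sub // normrM exprSr ler_pM //.
have B : 1 <= (b 0)%:R :> R by rewrite ler1n.
have u2 : 2 <= (b 0).+1%:R + (b 0)%:R * x.
  by rewrite -natr1; have := mulr_ge0 (ler0n R (b 0)) x0; lra.
have v1 := branch_den_ge1 (b 0) y0.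
move: (_ + _ * x) (_ + _ * y) u2 v1 => u v u2 v1.
have uv : 2 <= u * v by have : 0 <= u * (v - 1); [rewrite mulr_ge0 //; lra | lra].
have uv0 : 0 < u * v by lra.
by rewrite ger0_norm ?invr_ge0 ?(ltW uv0) // lef_pV2 ?posrE.
Qed.

Definition cfrac1 b : R := cfrac R (interleave1 b).

Lemma is_cvg_convergent b : (forall i, (0 < b i)%N) ->
  cvgn (convergent R (interleave1 b)).
Proof.
move=> b0; apply/cauchy_cvgP/cauchy_exP => e e0.
have [k ke] : exists k, 2^-1 ^+ k < e :> R.
  have h : `|2^-1 : R| < 1 by rewrite ger0_norm ?invr_ge0 // invf_lt1 // ltr1n.
  have /cvgr0_norm_lt /(_ e e0) [N _ /(_ N (leqnn N))] := cvg_expr h.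
  by rewrite /= ger0_norm ?exprn_ge0 ?invr_ge0 // => ?; exists N.
exists (convergent R (interleave1 b) k.*2), k.*2 => // n /= kn.
rewrite -ball_normE /=.
apply: le_lt_trans ke.
by have := convergent_contract k 0 (n - k.*2) b0; rewrite subnKC // addn0.
Qed.

Lemma cfrac1_itv b : (forall i, (0 < b i)%N) -> 0 <= cfrac1 b <= 1.
Proof.
move=> b0; have cb := is_cvg_convergent b0; apply/andP; split.
  apply: limr_ge => //; apply: nearW => n.
  by have [/andP[]] := convergent_branch n b0.
apply: limr_le => //; apply: nearW => n.
by have [/andP[]] := convergent_branch n b0.
Qed.

(** The limit of the convergents inherits the recursion of the convergents,
    [branch] being continuous on the unit interval. *)
Lemma cfrac1_branch b : (forall i, (0 < b i)%N) ->
  cfrac1 b = branch (b 0) (cfrac1 (fun i => b i.+1)).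
Proof.
move=> b0; have b1 i : (0 < b i.+1)%N by [].
have cb := is_cvg_convergent b0; have cb1 := is_cvg_convergent b1.
have c1 : convergent R (interleave1 b) (n + 2) @[n --> \oo] --> cfrac1 b.
  by rewrite (cvg_shiftn 2).
suff c2 : convergent R (interleave1 b) (n + 2) @[n --> \oo] -->
    branch (b 0) (cfrac1 (fun i => b i.+1)) by apply: cvg_unique c1 c2.
rewrite (_ : (fun n => _) = fun n =>
    branch (b 0) (convergent R (interleave1 (fun i => b i.+1)) n)); last first.
  by apply/funext => n; rewrite addn2; have [_ ->] := convergent_branch n b0.
have /andP[x0 _] := cfrac1_itv b1.
apply: cvgM; first by apply: cvgD => //; exact: cvg_cst.
apply: cvgV; first by have := branch_den_ge1 (b 0) x0 => ?; apply/eqP; lra.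
by apply: cvgD; [exact: cvg_cst | apply: cvgM => //; exact: cvg_cst].
Qed.
End ContinuedFraction.

(** * Masses on trees *)

(** A mass on the nodes of a tree that never exceeds the total mass of the
    children cannot be lost: any family of cylinders that covers the boundary
    carries at least the mass of the root.  Call load of w the mass of the
    cylinders of the family inside w.  If the load of the root were smaller than
    its mass, the same would hold for some child, and so on along a branch; but
    this branch meets a node of the family, whose load is at least its mass.
    Following one branch replaces the compactness argument that would extract a
    finite subcover. *)
Lemma tree_mass_le (R : realType) (I : finType) (phi : seq I -> R)
    (u : nat -> seq I) :
  (forall w, 0 <= phi w) ->
  (forall w, phi w <= \sum_(i : I) phi (rcons w i)) ->
  (forall a : nat -> I, exists n, mkseq a (size (u n)) = u n) ->
  ((phi [::])%:E <= \sum_(0 <= n <oo) (phi (u n))%:E)%E.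
Proof.
move=> phi0 phi_sub ucover; rewrite leNgt; apply/negP => root_lt.
pose below w n : \bar R := if prefix w (u n) then (phi (u n))%:E else 0%E.
have below0 w n : (0 <= below w n)%E by rewrite /below; case: ifP; rewrite ?lee_fin.
pose load w : \bar R := (\sum_(0 <= n <oo) below w n)%E.
have load_le w n : u n = w -> ((phi w)%:E <= load w)%E.
  move=> unw.
  apply: le_trans (nneseries_lim_ge n.+1 (fun m _ _ => below0 w m)).
  rewrite big_nat_recr //= {2}/below unw prefix_refl leeDr //.
  by apply: sume_ge0 => m _.
have load_split w : (load w < (phi w)%:E)%E ->
    load w = (\sum_(i : I) load (rcons w i))%E.
  move=> lt_w; rewrite -nneseries_sum //; apply: eq_eseriesr => n _.
  rewrite /below; case: ifPn => [/prefixP[[|i t] unE]|wNun].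
  - rewrite cats0 in unE.
    by have := load_le _ _ unE; rewrite leNgt lt_w.
  - rewrite unE (bigD1 i) //= -cat_rcons prefix_prefix big1 ?adde0 // => j ji.
    case: ifPn => // /prefixP[t' /eqP].
    by rewrite eqseq_cat ?size_rcons // eqseq_rcons => /andP[/andP[_ /eqP ij] _]; rewrite ij eqxx in ji.
  - rewrite big1 // => j _; case: ifPn => // /prefixP[t unE].
    by rewrite unE -cats1 -catA prefix_prefix in wNun.
have /choice[next nextP] (w : seq I) : exists i : I,
    (load w < (phi w)%:E -> load (rcons w i) < (phi (rcons w i))%:E)%E.
  have [lt_w|] := boolP (load w < (phi w)%:E)%E; last first.
    have [i _|I0 wN] := pickP (@predT I); first by exists i.
    have := phi_sub [::]; rewrite big_pred0 // => phi_nil.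
    have : ((phi [::])%:E <= \sum_(0 <= n <oo) (phi (u n))%:E)%E.
      apply: (@le_trans _ _ 0%E); first by rewrite lee_fin.
      by apply: nneseries_ge0 => n _ _; rewrite lee_fin.
    by rewrite leNgt root_lt.
  suff /existsP[i ?] : [exists i : I,
      load (rcons w i) < (phi (rcons w i))%:E]%E by exists i.
  apply: contraT; rewrite negb_exists => /forallP noi.
  have := lt_w; rewrite load_split // ltNge => /negP[].
  apply: le_trans (_ : (\sum_(i : I) (phi (rcons w i))%:E <= _)%E).
    by rewrite sumEFin lee_fin.
  by apply: lee_sum => i _; rewrite leNgt; exact: noi.
(* The branch along which the load stays below the mass. *)
pose path n := iter n (fun w => rcons w (next w)) [::].
have load_path n : (load (path n) < (phi (path n))%:E)%E.
  elim: n => [|n]; last exact: nextP.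
  apply: le_lt_trans root_lt; apply: lee_nneseries => // n _.
  by rewrite /below; case: ifP; rewrite ?lee_fin.
have pathE n : mkseq (fun k => next (path k)) n = path n.
  by elim: n => // n IH; rewrite mkseqS IH.
have [n] := ucover (fun k => next (path k)); rewrite pathE => /esym/load_le.
by rewrite leNgt load_path.
Qed.

(** * Coding and separation of points *)

(** The bottom row (q', q) of a product of branch matrices, multiplied on the
    right by (1, 1; b, b + 1). *)
Definition den_step (s : nat * nat) (b : nat) : nat * nat :=
  (s.1 + b * s.2, s.1 + b.+1 * s.2)%N.

Section Coding.
Variables (R : realType) (A : nat).
Implicit Types (a : nat -> 'I_A) (u w : seq 'I_A) (s : nat * nat) (x y : R).

(** The digit attached to the letter i of 'I_A is i + 1, so that every sequence
    of letters codes a point. *)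
Definition point a : R := cfrac1 R (fun i => (a i).+1).

Definition den_from s w : nat * nat := foldl (fun s (i : 'I_A) => den_step s i.+1) s w.

(** Starting from (1, 1) instead of the bottom row (0, 1) of the identity keeps
    q'/q between 1/2 and 1 for every word, the empty one included; this is the
    range on which the weights of words will have to be controlled. *)
Definition den w := den_from (1, 1)%N w.

Lemma point_itv a : 0 <= point a <= 1. Proof. exact: cfrac1_itv. Qed.

Lemma point_branch a : point a = branch (a 0).+1 (point (fun i => a i.+1)).
Proof. exact: cfrac1_branch. Qed.

Lemma den_step_bounds s b : (s.1 <= s.2 <= s.1.*2)%N ->
  ((den_step s b.+1).1 <= (den_step s b.+1).2 <= (den_step s b.+1).1.*2)%N /\
  ((s.2).*2 <= (den_step s b.+1).2)%N.
Proof. by case: s => p q; rewrite /den_step /= => /andP[h1 h2]; split; nia. Qed.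

Lemma den_from_bounds s w : (s.1 <= s.2 <= s.1.*2)%N ->
  ((den_from s w).1 <= (den_from s w).2 <= (den_from s w).1.*2)%N.
Proof.
by elim: w s => //= i w IH s /(den_step_bounds i)[+ _] => /IH.
Qed.

Lemma den_bounds w : ((den w).1 <= (den w).2 <= (den w).1.*2)%N.
Proof. exact: den_from_bounds. Qed.

Lemma den_rcons w i : den (rcons w i) = den_step (den w) i.+1.
Proof. by rewrite /den /den_from foldl_rcons. Qed.

Lemma size_lt_den w : (size w < (den w).2)%N.
Proof.
elim/last_ind: w => // w i IH; rewrite size_rcons den_rcons.
have [_] := den_step_bounds i (den_bounds w); lia.
Qed.

(** The distance between the images of x and y under a matrix of determinant 1
    with bottom row s. *)
Definition rel_dist s x y : R :=
  `|x - y| / ((s.2%:R + s.1%:R * x) * (s.2%:R + s.1%:R * y)).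

(** The chain rule: [rel_dist] does not change when a digit moves from the two
    points into the matrix.  The separation of two points with a common prefix is
    therefore read off from the denominators of the prefix. *)
Lemma rel_dist_branch s b x y : (0 < s.2)%N -> 0 <= x -> 0 <= y ->
  rel_dist s (branch b x) (branch b y) = rel_dist (den_step s b) x y.
Proof.
case: s => p q /= q0 x0 y0.
have Dx := branch_den_ge1 b x0; have Dy := branch_den_ge1 b y0.
have Q0 : 0 < q%:R :> R by rewrite ltr0n.
have P0 : 0 <= p%:R :> R by [].
have E z : 0 <= z -> q%:R + p%:R * branch b z =
    ((den_step (p, q) b).2%:R + (den_step (p, q) b).1%:R * z) /
    (b.+1%:R + b%:R * z) :> R.
  move=> /(branch_den_ge1 b) + ; rewrite /branch /= !natrD !natrM -natr1 => D.
  field; apply/eqP; lra.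
rewrite /rel_dist !E // branch_sub //.
have F z : 0 <= z -> 0 < (den_step (p, q) b).2%:R + (den_step (p, q) b).1%:R * z :> R.
  move=> z0; rewrite ltr_pwDl ?mulr_ge0 // ltr0n /=; nia.
have := F _ x0; have := F _ y0.
move: (_ + _ * y) (_ + _ * x) => u v u0 v0.
have DD : 0 < (b.+1%:R + b%:R * x) * (b.+1%:R + b%:R * y) :> R.
  by rewrite mulr_gt0 //; lra.
rewrite normrM normfV (ger0_norm (ltW DD)).
field; rewrite !gt_eqF //; lra.
Qed.

(** The image of [branch b] is [1 / (b + 1), 1 / (b + 1/2)], so the images for
    different digits leave gaps between them. *)
Lemma branch_gap (b b' : nat) x y : (b < b' < A)%N -> 0 <= x <= 1 -> 0 <= y <= 1 ->
  ((A * A.*2.+1)%N%:R)^-1 <= branch b.+1 x - branch b'.+1 y.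
Proof.
move=> /andP[bb' b'A] /andP[x0 x1] /andP[y0 y1].
have B0 : 0 <= b%:R :> R by [].
have BB : b%:R + 1 <= b'%:R :> R by rewrite natr1 ler_nat.
have lo : (b%:R + 2)^-1 <= branch b.+1 x.
  rewrite /branch -!natr1 ler_pdivlMr; last first.
    by have := mulr_ge0 B0 x0; lra.
  rewrite mulrC ler_pdivrMr; last by lra.
  by have := mulr_ge0 B0 x0; lra.
have hi : branch b'.+1 y <= 2 / (2 * b%:R + 5).
  rewrite /branch -!natr1 ler_pdivrMr; last first.
    by have := mulr_ge0 (ler0n R b') y0; lra.
  rewrite mulrAC ler_pdivlMr; last by lra.
  have : 0 <= (b'%:R - b%:R - 1) * (1 + y) :> R by rewrite mulr_ge0 //; lra.
  lra.
apply: le_trans (lerB lo hi).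
rewrite [leRHS](_ : _ = ((b%:R + 2) * (2 * b%:R + 5))^-1); last first.
  by field; apply/andP; split; apply/eqP; lra.
rewrite lef_pV2 ?posrE; last 2 first.
- by rewrite ltr0n muln_gt0; lia.
- by rewrite mulr_gt0 //; lra.
rewrite (_ : (b%:R + 2) * _ = ((b + 2) * (2 * b + 5))%N%:R :> R) ?ler_nat; last first.
  by rewrite natrM (natrD _ b) (natrD _ (2 * b)) natrM.
by apply: leq_mul; lia.
Qed.

Lemma point_gap a a' : a 0 <> a' 0 -> ((A * A.*2.+1)%N%:R)^-1 <= `|point a - point a'|.
Proof.
wlog lt_aa' : a a' / (a 0 < a' 0)%N => [WL ne|_].
  have [/WL|/WL|/val_inj //] := ltngtP (a 0) (a' 0); first exact.
  by rewrite distrC; apply; exact/nesym.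
rewrite (point_branch a) (point_branch a'); apply: le_trans (ler_norm _).
by apply: branch_gap; rewrite ?point_itv // lt_aa' ltn_ord.
Qed.

Lemma rel_dist_ge n : forall s a a', (0 < s.2)%N -> (s.1 <= s.2 <= s.1.*2)%N ->
  (forall i, (i < n)%N -> a i = a' i) -> a n <> a' n ->
  (4 * (A * A.*2.+1)%N%:R)^-1 / (den_from s (mkseq a n)).2%:R ^+ 2 <=
    rel_dist s (point a) (point a').
Proof.
elim: n => [|n IH] s a a' s0 sb eq_aa' ne_aa'; last first.
  rewrite (point_branch a) (point_branch a') -eq_aa' // rel_dist_branch //; last 2 first.
  - by have /andP[] := point_itv (fun i => a i.+1).
  - by have /andP[] := point_itv (fun i => a' i.+1).
  have [sb' _] := den_step_bounds (a 0) sb.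
  have s0' : (0 < (den_step s (a 0).+1).2)%N by rewrite /=; nia.
  rewrite (_ : mkseq a n.+1 = a 0%N :: mkseq (fun i => a i.+1) n); last first.
    by rewrite /mkseq -[iota 0 n.+1]/(0%N :: iota (1 + 0) n) iotaDl map_cons -map_comp.
  by apply: IH => // i; apply: (eq_aa' i.+1).
rewrite /mkseq /= /rel_dist.
have q0 : 0 < s.2%:R :> R by rewrite ltr0n.
have pq : s.1%:R <= s.2%:R :> R by rewrite ler_nat; case/andP: sb.
have D (z : R) : 0 <= z <= 1 -> 0 < s.2%:R + s.1%:R * z <= 2 * s.2%:R.
  move=> /andP[z0 z1]; rewrite ltr_pwDl ?mulr_ge0 //=.
  have : 0 <= s.1%:R * (1 - z) by rewrite mulr_ge0 // subr_ge0.
  lra.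
have /andP[Dx0 Dx] := D _ (point_itv a); have /andP[Dy0 Dy] := D _ (point_itv a').
rewrite invfM (mulrC 4^-1) -mulrA -invfM ler_pM ?invr_ge0 ?mulr_ge0 ?exprn_ge0 //.
  exact: point_gap.
have -> : 4 * s.2%:R ^+ 2 = (2 * s.2%:R) * (2 * s.2%:R) :> R by ring.
rewrite lef_pV2 ?posrE ?mulr_gt0 //.
by apply: ler_pM => //; exact: ltW.
Qed.

(** Points that separate at level n are as far apart as q^-2, up to a constant
    depending on A only. *)
Lemma point_separation n a a' :
  (forall i, (i < n)%N -> a i = a' i) -> a n <> a' n ->
  (4 * (A * A.*2.+1)%N%:R)^-1 / (den (mkseq a n)).2%:R ^+ 2 <= `|point a - point a'|.
Proof.
move=> eq_aa' ne_aa'.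
apply: le_trans (rel_dist_ge (s := (1, 1)%N) _ _ eq_aa' ne_aa') _ => //.
rewrite /rel_dist /= !mul1r.
have /andP[x0 _] := point_itv a; have /andP[y0 _] := point_itv a'.
have D : 1 <= (1 + point a) * (1 + point a') by have := mulr_ge0 x0 y0; lra.
by rewrite ler_pdivrMr ?ler_peMr //; lra.
Qed.
End Coding.

(** * Mass distribution *)

Lemma set_diam_fin (R : realType) (U : set R) (e : R) : U !=set0 ->
  (set_diam U <= e%:E)%E ->
  exists2 d : R, set_diam U = d%:E /\ 0 <= d <= e &
    forall x y, U x -> U y -> `|x - y| <= d.
Proof.
move=> [x0 Ux0] Ue.
have le_diam x y : U x -> U y -> (`|x - y|%:E <= set_diam U)%E.
  by move=> Ux Uy; apply: ereal_sup_ubound; exists x => //; exists y.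
have : (0%:E <= set_diam U)%E.
  by apply: le_trans (le_diam x0 x0 Ux0 Ux0); rewrite lee_fin.
move: Ue le_diam; case: (set_diam U) => [d | |] //=.
rewrite !lee_fin => de le_d d0; exists d; first by rewrite d0.
by move=> x y Ux Uy; have := le_d x y Ux Uy; rewrite lee_fin.
Qed.

(** The mass distribution principle for a mass [phi] of order at most q^-p: it
    bounds the Hausdorff measures of exponent at most p / 2 from below. *)
Section MassDistribution.
Variables (R : realType) (A : nat) (p K : R) (phi : seq 'I_A -> R).
Hypothesis A_gt0 : (0 < A)%N.
Hypothesis p_gt0 : 0 < p.
Hypothesis K_gt0 : 0 < K.
Hypothesis phi_ge0 : forall w, 0 <= phi w.
Hypothesis phi_den : forall w, phi w <= K * (den w).2%:R `^ (- p).
Hypothesis phi_sub : forall w, phi w <= \sum_(i : 'I_A) phi (rcons w i).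

Let gap : R := 4 * (A * A.*2.+1)%N%:R.

Let gap_gt0 : 0 < gap.
Proof. by rewrite mulr_gt0 // ltr0n muln_gt0 A_gt0. Qed.

Lemma long_words_light (eta : R) : 0 < eta ->
  exists N, forall w, size w = N -> phi w <= eta.
Proof.
move=> eta0; pose N := Num.bound ((K / eta) `^ p^-1).
exists N => w wN; apply: le_trans (phi_den w) _.
rewrite powRN ler_pdivrMr ?powR_gt0 ?ltr0n ?(leq_ltn_trans _ (size_lt_den w)) //.
rewrite mulrC -ler_pdivrMr //.
have /andP[Ke0 Ke] : 0 <= (K / eta) `^ p^-1 <= (den w).2%:R.
  rewrite powR_ge0 /=; apply: le_trans (ltW (archi_boundP (powR_ge0 _ _))) _.
  by rewrite ler_nat -/N -wN ltnW // size_lt_den.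
have := ge0_ler_powR (ltW p_gt0) Ke0 (ler0n R _) Ke.
by rewrite -powRrM mulVf ?gt_eqF // powRr1 // divr_ge0 // ltW.
Qed.

Lemma phi_le_dist n a a' :
  (forall i, (i < n)%N -> a i = a' i) -> a n <> a' n ->
  phi (mkseq a n) <= K * (gap * `|point R a - point R a'|) `^ (p / 2).
Proof.
move=> eq_aa' ne_aa'; apply: le_trans (phi_den _) _.
rewrite ler_pM2l //.
have := point_separation R eq_aa' ne_aa'; rewrite -/gap.
have : (0 : R) < (den (mkseq a n)).2%:R.
  by rewrite ltr0n (leq_ltn_trans _ (size_lt_den _)).
move: (den _).2%:R => q q0 le_dist.
have -> : q `^ (- p) = (q ^- 2) `^ (p / 2).
  have -> : q ^- 2 = q `^ (- 2) by rewrite powRN powR_mulrn ?ltW.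
  by rewrite -powRrM; congr (_ `^ _); field.
apply: ge0_ler_powR; rewrite ?nnegrE ?divr_ge0 ?(ltW p_gt0) //.
- by rewrite invr_ge0 exprn_ge0 // ltW.
- by rewrite mulr_ge0 // ltW.
by rewrite -ler_pdivrMl.
Qed.

(** Take the longest cylinder that contains the part of the set U in the
    Cantor set.  Two points of U separate there, so the mass of this cylinder is
    at most a multiple of d^(p/2).  If there is no longest one, as when U
    contains a single point, a long cylinder has mass at most [eta]. *)
Lemma covering_cylinder (U : set R) (d eta : R) : 0 <= d -> 0 < eta ->
  (forall x y, U x -> U y -> `|x - y| <= d) ->
  exists2 w, (forall a : nat -> 'I_A, U (point R a) -> mkseq a (size w) = w) &
    phi w <= K * (gap * d) `^ (p / 2) + eta.
Proof.
move=> d0 eta0 Ud; have [N Nlight] := long_words_light eta0.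
pose captures (w : seq 'I_A) := forall a : nat -> 'I_A, U (point R a) -> mkseq a (size w) = w.
pose good w := captures w /\ phi w <= K * (gap * d) `^ (p / 2) + eta.
have /(_ N) [[w [size_w w_capt]]|[w [w_capt w_le]]] :
    forall n, (exists w, size w = n /\ captures w) \/ exists w, good w.
- elim=> [|n [[w [size_w w_capt]]|]]; [by left; exists [::] | | by right].
  have [[i wi]|noi] := pselect (exists i, captures (rcons w i)).
    by left; exists (rcons w i); rewrite size_rcons size_w.
  have [[a Ua]|noa] := pselect (exists a : nat -> 'I_A, U (point R a)); last first.
    left; exists (rcons w (Ordinal A_gt0)); rewrite size_rcons size_w; split => // a Ua.
    by case: noa; exists a.
  right; exists w; split => //.
  have : ~ captures (rcons w (a n)) by move=> ?; apply: noi; exists (a n).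
  move=> /existsNP[a' /not_implyP[Ua' ne]].
  have wa := w_capt _ Ua; have wa' := w_capt _ Ua'; rewrite size_w in wa wa'.
  rewrite -wa; apply: (@le_trans _ _ (K * (gap * d) `^ (p / 2))); last first.
    by rewrite lerDl ltW.
  apply: le_trans (phi_le_dist (a := a) (a' := a') _ _) _.
  + move=> i lt_in; rewrite -(nth_mkseq (a 0%N) a lt_in) -(nth_mkseq (a 0%N) a' lt_in).
    by rewrite wa wa'.
  + by move=> aa'; apply: ne; rewrite size_rcons size_w mkseqS wa' aa'.
  rewrite ler_pM2l //; apply: ge0_ler_powR; rewrite ?nnegrE ?divr_ge0 ?(ltW p_gt0) //.
  * by rewrite mulr_ge0 // ltW.
  * by rewrite mulr_ge0 // ltW.
  by rewrite ler_pM2l // Ud.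
- exists w => //; apply: le_trans (Nlight _ size_w) _.
  by rewrite lerDr mulr_ge0 ?powR_ge0 // ltW.
by exists w.
Qed.

Lemma gauge_ge (s d : R) (U : set R) : 0 <= s <= p / 2 -> U !=set0 ->
  set_diam U = d%:E -> 0 <= d <= 1 ->
  ((d `^ (p / 2))%:E <= gauge s U)%E.
Proof.
move=> /andP[s0 sp] U0 Ud /andP[d0 d1].
rewrite /gauge ifN; last by apply/set0P.
rewrite Ud poweR_EFin lee_fin; move: d0; rewrite le_eqVlt => /predU1P[<-|d0].
  by rewrite powR0 ?powR_ge0 // gt_eqF // divr_gt0.
by apply: ger_powR => //; rewrite d0.
Qed.

Lemma hausdorff_measure_ge (s : R) (E : set R) : 0 <= s <= p / 2 ->
  (forall a : nat -> 'I_A, E (point R a)) ->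
  ((phi [::] / (K * gap `^ (p / 2)))%:E <= hausdorff_measure s E)%E.
Proof.
move=> sp Epoint.
have C0 : 0 < K * gap `^ (p / 2) by rewrite mulr_gt0 // powR_gt0.
apply: (@le_trans _ _ (hausdorff_content s 1 E)); last first.
  by apply: ereal_sup_ubound; exists 1 => //=.
apply: le_ereal_inf_tmp => _ [U [EU Udiam] <-].
have gauge0 n : (0 <= gauge s (U n))%E.
  by rewrite /gauge; case: ifP => // _; exact: poweR_ge0.
rewrite EFinM muleC -lee_pdivlMl ?invr_gt0 // invrK.
apply/lee_addgt0Pr => e e0.
(* Sets of diameter 0 may contribute nothing to the cost of the covering, while
   their cylinders have mass; geometrically decreasing errors absorb it. *)
have eta0 n : 0 < e / (2 ^ n.+1)%:R by rewrite divr_gt0 // ltr0n expn_gt0.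
have /choice[w wP] n : exists w : seq 'I_A,
    (forall a : nat -> 'I_A, U n (point R a) -> mkseq a (size w) = w) /\
    ((phi w)%:E <= (K * gap `^ (p / 2))%:E * gauge s (U n) + (e / (2 ^ n.+1)%:R)%:E)%E.
  have [U0|/set0P U0] := eqVneq (U n) set0.
    have [N light] := long_words_light (eta0 n).
    exists (nseq N (Ordinal A_gt0)); split => [a|]; first by rewrite U0.
    apply: (@le_trans _ _ (e / (2 ^ n.+1)%:R)%:E).
      by rewrite lee_fin light // size_nseq.
    by rewrite leeDr // mule_ge0 // lee_fin ltW.
  have [d [Ud /andP[d0 d1]] dP] := set_diam_fin U0 (Udiam n).
  have [w w_capt w_le] := covering_cylinder d0 (eta0 n) dP.
  exists w; split => //.
  apply: le_trans (_ : (K * (gap * d) `^ (p / 2) + e / (2 ^ n.+1)%:R)%:E <= _)%E.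
    by rewrite lee_fin.
  rewrite EFinD leeD2r // powRM ?(ltW gap_gt0) // mulrA EFinM lee_pmul2l ?lte_fin //.
  by apply: gauge_ge => //; rewrite d0.
have cover a : exists n, mkseq a (size (w n)) = w n.
  have [n _ Un] := EU _ (Epoint a).
  by exists n; have [w_capt _] := wP n; exact: w_capt.
apply: le_trans (tree_mass_le phi_ge0 phi_sub cover) _.
apply: le_trans (lee_nneseries _ (fun n _ => (wP n).2)) _.
  by move=> n _ _; rewrite lee_fin.
rewrite -nneseriesZl //; apply: epsilon_trick (ltW e0) => n.
by rewrite mule_ge0 // lee_fin ltW.
Qed.
End MassDistribution.

(** * Real powers and certified approximations *)

Section PowerEstimates.
Variable R : realType.
Implicit Types (p t x y : R).

(** The tangent of the convex function t^(-p) lies below its graph. *)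
Lemma powR_bernoulli p t x : 0 <= p -> 0 < t -> 0 < t + x ->
  t `^ (- p) * (1 - p * x / t) <= (t + x) `^ (- p).
Proof.
move=> p0 t0 tx0.
have z0 : 0 < 1 + x / t by rewrite -[1](divff (lt0r_neq0 t0)) -mulrDl divr_gt0.
have -> : t + x = t * (1 + x / t) by field; rewrite gt_eqF.
rewrite powRM ?(ltW t0) ?(ltW z0) // ler_wpM2l ?powR_ge0 //.
rewrite /powR gt_eqF //; apply: le_trans (expR_ge1Dx _).
rewrite lerD2l mulNr lerN2 -mulrA ler_wpM2l //.
by apply: le_ln1Dx; lra.
Qed.

Lemma powR_convex p t x y : 0 <= p -> 0 <= t <= 1 -> 0 < x -> 0 < y ->
  ((1 - t) * x + t * y) `^ (- p) <= (1 - t) * x `^ (- p) + t * y `^ (- p).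
Proof.
move=> p0 /andP[t0 t1] x0 y0; set m := _ + _.
have m0 : 0 < m.
  rewrite /m; have [->|tN0] := eqVneq t 0; first by rewrite subr0 mul1r mul0r addr0.
  by rewrite ltr_wpDl ?mulr_ge0 ?subr_ge0 ?(ltW x0) // mulr_gt0 // lt0r tN0.
(* Jensen's inequality from the tangent at the barycentre m. *)
have hx := powR_bernoulli (x := x - m) p0 m0; have hy := powR_bernoulli (x := y - m) p0 m0.
rewrite subrKC in hx; rewrite subrKC in hy.
have {}hx : (1 - t) * (m `^ (- p) * (1 - p * (x - m) / m)) <= (1 - t) * x `^ (- p).
  by rewrite ler_wpM2l ?subr_ge0 ?hx.
have {}hy : t * (m `^ (- p) * (1 - p * (y - m) / m)) <= t * y `^ (- p).
  by rewrite ler_wpM2l ?hy.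
apply: le_trans (lerD hx hy); rewrite le_eqVlt; apply/orP; left; apply/eqP.
have -> : (1 - t) * (m `^ (- p) * (1 - p * (x - m) / m)) +
    t * (m `^ (- p) * (1 - p * (y - m) / m)) =
    m `^ (- p) * (1 - p / m * (((1 - t) * x + t * y) - m)).
  by field; rewrite gt_eqF.
by rewrite -/m subrr mulr0 subr0 mulr1.
Qed.

Local Notation g x := (x `^ (- (31 / 20)) : R).

Lemma powR_root (m : R) : 0 < m -> g m ^+ 20 * m ^+ 31 = 1.
Proof.
move=> m0; rewrite -!powR_mulrn ?powR_ge0 ?(ltW m0) // -powRrM.
rewrite (_ : - (31 / 20) * 20%:R = - 31%:R); last by field.
by rewrite powRN mulVf // gt_eqF // powR_gt0.
Qed.

Lemma le_powR_root (S T m : R) : 0 <= S -> 0 <= T -> 0 < m ->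
  (T <= S * g m) = (T ^+ 20 * m ^+ 31 <= S ^+ 20).
Proof.
move=> S0 T0 m0.
rewrite -(ler_pXn2r (n := 20)) ?nnegrE ?mulr_ge0 ?powR_ge0 //.
by rewrite -(ler_pM2r (exprn_gt0 31 m0)) (exprMn _ S) -(mulrA _ (g m ^+ 20)) powR_root // mulr1.
Qed.

Lemma ge_powR_root (S T m : R) : 0 <= S -> 0 <= T -> 0 < m ->
  (S * g m <= T) = (S ^+ 20 <= T ^+ 20 * m ^+ 31).
Proof.
move=> S0 T0 m0.
rewrite -(ler_pXn2r (n := 20)) ?nnegrE ?mulr_ge0 ?powR_ge0 //.
by rewrite -(ler_pM2r (exprn_gt0 31 m0)) (exprMn _ S) -(mulrA _ (g m ^+ 20)) powR_root // mulr1.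
Qed.

(** A lower bound T for S m^(-31/20) obtained by extracting a fifth root x and
    then a fourth root, since m^(-31/20) = (m^(-1/5) / m^6)^(1/4). *)
Lemma le_powR_nested_root (Q S T x y m : R) :
  0 <= Q -> 0 <= S -> 0 <= T -> 0 <= x -> 0 < m -> S ^+ 20 = Q ^+ 6 ->
  x ^+ 5 * m <= Q -> y * m ^+ 6 <= x * Q -> T ^+ 4 <= y -> T <= S * g m.
Proof.
move=> Q0 S0 T0 x0 m0 SQ xQ yx Ty; rewrite le_powR_root // SQ.
have m6 : 0 <= m ^+ 6 by rewrite exprn_ge0 ?ltW.
have {}Ty : T ^+ 4 * m ^+ 6 <= x * Q by apply: le_trans yx; exact: ler_wpM2r.
have {Ty} : (T ^+ 4 * m ^+ 6) ^+ 5 <= (x * Q) ^+ 5.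
  by rewrite ler_pXn2r ?nnegrE ?mulr_ge0 ?exprn_ge0 ?(ltW m0).
rewrite (exprMn _ (T ^+ 4)) (exprMn _ x) -(exprM T) -(exprM m) => Ty.
rewrite (exprSr m 30) mulrA; apply: le_trans (ler_wpM2r (ltW m0) Ty) _.
by rewrite mulrAC exprS ler_wpM2r // exprn_ge0.
Qed.

End PowerEstimates.

(** Binary naturals as reals.  The definition is sealed because unification
    would otherwise expand large binary numbers in unary. *)
HB.lock Definition NR (R : realType) (n : N) : R := (N.to_nat n)%:R.

Section BinaryNaturals.
Variable R : realType.
Local Notation NR := (NR R).
Local Open Scope N_scope.
Implicit Types (m n : N).

Lemma NR_ge0 n : (0 <= NR n)%R. Proof. by rewrite NR.unlock ler0n. Qed.

Lemma NR_nat (k : nat) : NR (N.of_nat k) = k%:R%R.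
Proof. by rewrite !NR.unlock Nat2N.id. Qed.

Lemma NRD m n : NR (m + n) = (NR m + NR n)%R.
Proof. by rewrite !NR.unlock N2Nat.inj_add natrD. Qed.

Lemma NRM m n : NR (m * n) = (NR m * NR n)%R.
Proof. by rewrite !NR.unlock N2Nat.inj_mul natrM. Qed.

Lemma NRX m (k : nat) : NR (m ^ N.of_nat k) = (NR m ^+ k)%R.
Proof.
elim: k => [|k IH]; first by rewrite expr0 (NR_nat 1).
by rewrite Nat2N.inj_succ N.pow_succ_r' NRM IH exprS.
Qed.

Lemma NR_le m n : (m <= n)%num -> (NR m <= NR n)%R.
Proof.
by move=> /N.sub_add <-; rewrite NRD lerDr NR_ge0.
Qed.

Lemma NRB m n : (n <= m)%num -> NR (m - n) = (NR m - NR n)%R.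
Proof. by move=> /N.sub_add mn; rewrite -{2}mn NRD addrK. Qed.

Lemma NR_div_le m n : (NR (m / n) * NR n <= NR m)%R.
Proof. by rewrite -NRM; apply: NR_le; rewrite N.mul_comm; exact: N.Div0.mul_div_le. Qed.

Lemma NR_div_gt m n : n <> 0%num -> (NR m <= (NR (m / n) + 1) * NR n)%R.
Proof.
move=> n0; rewrite -[1%R]/(1%:R)%R -(NR_nat 1) -NRD -NRM; apply: NR_le.
by rewrite N.mul_comm N.add_1_r; apply/N.lt_le_incl/N.mul_succ_div_gt.
Qed.

Lemma NR_sqrt m : (NR (N.sqrt m) ^+ 2 <= NR m)%R.
Proof.
rewrite expr2 -NRM; apply: NR_le; by have [] := N.sqrt_spec m (N.le_0_l m).
Qed.
End BinaryNaturals.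

Section Certificate.
Local Open Scope N_scope.

(** The largest number satisfying a decreasing predicate, one binary digit at a
    time; soundness of the certificate only uses that the answer satisfies it. *)
Fixpoint bisect (P : N -> bool) (k : nat) (acc : N) : N :=
  if k is k'.+1 then
    let t := acc + 2 ^ N.of_nat k' in bisect P k' (if P t then t else acc)
  else acc.

(** The unit of the fixed-point approximations of m^(-31/20). *)
Definition scale : N := 2 ^ 36.

Definition pow_lower (m : N) : N :=
  let r := 2 ^ 120 / m in
  let x := bisect (fun t => t ^ 5 <=? r) 23 0 in
  N.sqrt (N.sqrt (x * 2 ^ 120 / m ^ 6)).

(** Adding 2 covers the rounding in [pow_lower]; this is tested for each
    argument by [pow_upper_ok] rather than proved in general. *)
Definition pow_upper (m : N) : N := pow_lower m + 2.

Definition pow_upper_ok (m : N) : bool := scale ^ 20 <=? pow_upper m ^ 20 * m ^ 31.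

(** Lower bounds at m - 8 and m + 8 for the tangent of t^(-31/20) at m, whose
    slope is -31/20 m^(-31/20) / m; here 62 / 5 = 8 * 31 / 20, and d + 1 is an
    upper bound for the same product. *)
Definition tangent_ends (m : N) : N * N :=
  let t := pow_lower m in let d := 62 * t / (5 * m) in (t + d, t - (d + 1)).

(** The argument 256 b + 16 k + 16 x of the powers at the midpoint
    x = l + 1/2 of a cell. *)
Definition node (k l : N) (n : nat) : N :=
  8 * (32 * N.of_nat n + 2 * k + 2 * l + 1).

(** Lower bounds at both ends of the cell [l, l + 1] for the sum over the digits
    1, ..., n of the tangents. *)
Fixpoint row (k l : N) (n : nat) : N * N :=
  if n is n'.+1 then
    let r := row k l n' in
    let v := tangent_ends (node k l n) in
    (r.1 + v.1, r.2 + v.2)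
  else (0, 0).

Lemma row1S k l n :
  (row k l n.+1).1 = (row k l n).1 + (tangent_ends (node k l n.+1)).1.
Proof. by []. Qed.

Lemma row2S k l n :
  (row k l n.+1).2 = (row k l n).2 + (tangent_ends (node k l n.+1)).2.
Proof. by []. Qed.

Definition chord_arg (k l : N) : N := 16 * k + (16 - k) * l.

(** The key inequality with a factor 20001/20000 to spare, at an end l of a
    cell, given a lower bound L for the tangents at this end. *)
Definition end_ok (l L : N) : bool :=
  [&& pow_upper_ok (chord_arg 9 l), pow_upper_ok (chord_arg 14 l) &
      20001 * (pow_upper (chord_arg 9 l) + 6 * pow_upper (chord_arg 14 l)) <=?
      20000 * L].

Definition cell_ok (l : N) : bool :=
  let r9 := row 9 l 110 in let r14 := row 14 l 110 in
  end_ok l (r9.1 + 6 * r14.1) && end_ok (l + 1) (r9.2 + 6 * r14.2).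

Lemma bisect_ind (P : N -> bool) k acc : P acc -> P (bisect P k acc).
Proof. by elim: k acc => //= k IH acc Pacc; apply: IH; case: ifP. Qed.

Lemma cells_ok : all (fun l => cell_ok (N.of_nat l)) (iota 8 8).
Proof. rewrite /is_true; vm_cast_no_check (erefl true). Qed.
End Certificate.

Section CertificateSoundness.
Variable R : realType.
Local Notation NR := (NR R).
Local Notation g x := (x `^ (- (31 / 20)) : R).
Implicit Types (m k l : N).

Lemma NR_gt0 m : m <> 0%num -> 0 < NR m.
Proof.
move=> mN0; rewrite lt0r NR_ge0 andbT NR.unlock pnatr_eq0.
by apply/eqP => m0; apply: mN0; exact: N2Nat.inj.
Qed.

Lemma pow_lowerP m : m <> 0%num -> NR (pow_lower m) <= NR scale * g (NR m).
Proof.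
move=> /NR_gt0 m0; rewrite /pow_lower; set r := (2 ^ 120 / m)%num.
set x := bisect _ _ _; set y := (_ / _)%num.
have SQ : NR scale ^+ 20 = NR (2 ^ 120)%num ^+ 6.
  have S20 : (scale ^ N.of_nat 20 = (2 ^ 120) ^ N.of_nat 6)%num by vm_compute.
  by rewrite -(NRX R scale 20) -(NRX R (2 ^ 120)%num 6) S20.
have xQ : NR x ^+ 5 * NR m <= NR (2 ^ 120)%num.
  apply: le_trans (NR_div_le R _ m); rewrite ler_pM2r // -(NRX R x 5).
  apply: NR_le; apply/N.leb_le.
  apply: (@bisect_ind (fun t => t ^ 5 <=? r)%num); exact/N.leb_le/N.le_0_l.
have yx : NR y * NR m ^+ 6 <= NR x * NR (2 ^ 120)%num.
  by rewrite -(NRX R m 6) -(NRM R x); exact: NR_div_le.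
have Ty : NR (N.sqrt (N.sqrt y)) ^+ 4 <= NR y.
  apply: (@le_trans _ _ (NR (N.sqrt y) ^+ 2)); last exact: NR_sqrt.
  rewrite (exprM _ 2 2) ler_pXn2r ?nnegrE ?exprn_ge0 ?NR_ge0 //.
  exact: NR_sqrt.
exact: le_powR_nested_root (NR_ge0 R _) (NR_ge0 R _) (NR_ge0 R _) (NR_ge0 R _) m0
  SQ xQ yx Ty.
Qed.

Lemma pow_upperP m : pow_upper_ok m -> NR scale * g (NR m) <= NR (pow_upper m).
Proof.
rewrite /pow_upper_ok => /N.leb_le; move: (pow_upper m) => u ok.
have m0 : 0 < NR m.
  apply: NR_gt0 => m0; move: ok; rewrite m0 (_ : (0 ^ 31 = 0)%num) // N.mul_0_r.
  by move/N.le_0_r; exact: (N.pow_nonzero scale 20).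
have {}ok : NR (scale ^ 20)%num <= NR (u ^ 20 * m ^ 31)%num by exact: NR_le.
rewrite (ge_powR_root (NR_ge0 R _) (NR_ge0 R _) m0).
by rewrite NRM (NRX R scale 20) (NRX R u 20) (NRX R m 31) in ok.
Qed.

Lemma tangent_endsP m (t : R) : (13 <= m)%num -> 0 <= t <= 1 ->
  (1 - t) * NR (tangent_ends m).1 + t * NR (tangent_ends m).2 <=
  NR scale * g (NR m + 8 * (2 * t - 1)).
Proof.
move=> m13 /andP[t0 t1].
have M13 : 13 <= NR m by rewrite -[13]/(13%:R) -(NR_nat R 13); exact: NR_le.
have mN0 : m <> 0%num by lia.
move: (pow_lowerP mN0); rewrite /tangent_ends; move: (pow_lower m) => T TG.
have D1 := NR_div_le R (62 * T) (5 * m).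
have D2 : NR (62 * T) <= (NR (62 * T / (5 * m)) + 1) * NR (5 * m).
  by apply: NR_div_gt; lia.
move: (_ / _)%num D1 D2 => d; rewrite -[(_, _).1]/(T + d)%num -[(_, _).2]/(T - (d + 1))%num.
rewrite !NRM (NR_nat R 62) (NR_nat R 5) => D1 D2.
have T0 := NR_ge0 R T.
have lo : NR (T + d) <= NR T * (1 + 62 / (5 * NR m)).
  rewrite NRD mulrDr mulr1 lerD2l mulrA ler_pdivlMr; last by lra.
  lra.
have hi : NR (T - (d + 1)) <= NR T * (1 - 62 / (5 * NR m)).
  have [dT|/N.lt_le_incl/N.sub_0_le ->] := N.le_gt_cases (d + 1) T; last first.
    by rewrite (NR_nat R 0) mulr_ge0 // subr_ge0 ler_pdivrMr; lra.
  rewrite NRB // NRD (NR_nat R 1) mulrBr mulr1 lerD2l lerN2 mulrA ler_pdivrMr; last by lra.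
  lra.
have M0 : 0 < NR m by lra.
have c0 : 0 <= 1 - 31 / 20 * (8 * (2 * t - 1)) / NR m.
  by rewrite subr_ge0 ler_pdivrMr //; lra.
apply: (@le_trans _ _ (NR T * (1 - 31 / 20 * (8 * (2 * t - 1)) / NR m))).
  have -> : NR T * (1 - 31 / 20 * (8 * (2 * t - 1)) / NR m) =
     (1 - t) * (NR T * (1 + 62 / (5 * NR m))) + t * (NR T * (1 - 62 / (5 * NR m))).
    by field; rewrite gt_eqF.
  by apply: lerD; apply: ler_wpM2l => //; lra.
apply: le_trans (ler_wpM2r c0 TG) _; rewrite -(mulrA (NR scale)) ler_wpM2l ?NR_ge0 //.
apply: powR_bernoulli => //.
lra.
Qed.

Lemma rowP k l (t : R) n : 0 <= t <= 1 ->
  (1 - t) * NR (row k l n).1 + t * NR (row k l n).2 <=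
  NR scale * \sum_(i < n) g (256 * i.+1%:R + 16 * NR k + 16 * (NR l + t)).
Proof.
move=> t01; elim: n => [|n IH]; first by rewrite big_ord0 (NR_nat R 0) !mulr0 addr0.
have node13 : (13 <= node k l n.+1)%num by rewrite /node; lia.
have := tangent_endsP node13 t01.
have -> : NR (node k l n.+1) + 8 * (2 * t - 1) =
    256 * n.+1%:R + 16 * NR k + 16 * (NR l + t).
  rewrite /node !(NRM, NRD) NR_nat (NR_nat R 8) (NR_nat R 32) (NR_nat R 2) (NR_nat R 1).
  ring.
rewrite big_ord_recr row1S row2S (mulrDr (NR scale)).
move: (row k l n).1 (row k l n).2 (tangent_ends _).1 (tangent_ends _).2 IH => a b c d IH cd.
rewrite !NRD (mulrDr (1 - t)) (mulrDr t) addrACA; exact: lerD IH cd.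
Qed.

End CertificateSoundness.

(** * The key inequality *)

Section KeyInequality.
Variable R : realType.
Local Notation NR := (NR R).
Local Notation g x := (x `^ (- (31 / 20)) : R).

Lemma end_okP (l L : N) : end_ok l L ->
  NR 20001 * (NR scale * (g (144 + 7 * NR l) + 6 * g (224 + 2 * NR l))) <=
  NR 20000 * NR L.
Proof.
have arg9 : NR (chord_arg 9 l) = 144 + 7 * NR l.
  rewrite /chord_arg -[(16 * 9)%num]/(144%num) -[(16 - 9)%num]/(7%num).
  by rewrite NRD NRM (NR_nat R 144) (NR_nat R 7).
have arg14 : NR (chord_arg 14 l) = 224 + 2 * NR l.
  rewrite /chord_arg -[(16 * 14)%num]/(224%num) -[(16 - 14)%num]/(2%num).
  by rewrite NRD NRM (NR_nat R 224) (NR_nat R 2).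
rewrite /end_ok => /and3P[/(pow_upperP R) + /(pow_upperP R) +].
rewrite arg9 arg14.
move: (pow_upper (chord_arg 9 l)) (pow_upper (chord_arg 14 l)) => u v gu gv.
move=> /N.leb_le/(NR_le R); rewrite !NRM NRD NRM (NR_nat R 6).
apply: le_trans; rewrite ler_wpM2l ?NR_ge0 //; clear -gu gv.
lra.
Qed.

Lemma chord_le (k j x t : R) : 0 < k -> 0 <= j -> 0 <= x -> 0 <= t <= 1 ->
  g (k + j * (x + t)) <= (1 - t) * g (k + j * x) + t * g (k + j * (x + 1)).
Proof.
move=> k0 j0 x0 t01.
have -> : k + j * (x + t) = (1 - t) * (k + j * x) + t * (k + j * (x + 1)) by ring.
apply: powR_convex => //; rewrite ltr_pwDl ?mulr_ge0 ?addr_ge0 //.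
Qed.

(** Between the ends of a cell, one side lies above its tangents and the other
    below its chords, so an inequality at the ends extends to the cell. *)
Lemma interpolate_ends (u v S t a b c d p p0 p1 q q0 q1 s s' : R) :
  0 <= u -> 0 <= v -> 0 < S -> 0 <= t <= 1 ->
  u * (S * (p0 + 6 * q0)) <= v * (a + 6 * c) ->
  u * (S * (p1 + 6 * q1)) <= v * (b + 6 * d) ->
  (1 - t) * a + t * b <= S * s -> (1 - t) * c + t * d <= S * s' ->
  p <= (1 - t) * p0 + t * p1 -> q <= (1 - t) * q0 + t * q1 ->
  u * (p + 6 * q) <= v * (s + 6 * s').
Proof.
move=> u0 v0 S0 /andP[t0 t1] e0 e1 rs rs' hp hq; rewrite -(ler_pM2l S0).
have t1' : 0 <= 1 - t by rewrite subr_ge0.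
have uS : 0 <= u * S by rewrite mulr_ge0 // ltW.
have {}e0 := ler_wpM2l t1' e0; have {}e1 := ler_wpM2l t0 e1.
have {}rs := ler_wpM2l v0 rs; have {}rs' := ler_wpM2l v0 rs'.
have {}hp := ler_wpM2l uS hp; have {}hq := ler_wpM2l uS hq.
lra.
Qed.

Lemma cell_okP (l : N) (t : R) : cell_ok l -> 0 <= t <= 1 ->
  NR 20001 * (g (144 + 7 * (NR l + t)) + 6 * g (224 + 2 * (NR l + t))) <=
  NR 20000 * (\sum_(i < 110) g (256 * i.+1%:R + 144 + 16 * (NR l + t)) +
           6 * \sum_(i < 110) g (256 * i.+1%:R + 224 + 16 * (NR l + t))).
Proof.
move=> + t01; have := rowP 9 l 110 t01; have := rowP 14 l 110 t01; rewrite /cell_ok.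
rewrite (_ : 16 * NR 9 = 144); last by rewrite (NR_nat R 9); ring.
rewrite (_ : 16 * NR 14 = 224); last by rewrite (NR_nat R 14); ring.
move: (row 9 l 110) (row 14 l 110) => [a b] [c d] row14 row9.
move=> /andP[/end_okP end0 /end_okP end1].
move: end0 end1; rewrite !NRD !NRM (NR_nat R 6) (NR_nat R 1) => end0 end1.
have l0 := NR_ge0 R l.
have S0 : 0 < NR scale by exact: NR_gt0.
apply: (interpolate_ends (NR_ge0 R _) (NR_ge0 R _) S0 t01 end0 end1 row9 row14);
  by apply: chord_le.

Qed.

(** At exponent 31/20 the weight of a word with 16 q'/q = x is smaller than the
    total weight of its children, by a definite factor. *)
Lemma key_inequality (x : R) : 8 <= x <= 16 ->
  NR 20001 * (g (144 + 7 * x) + 6 * g (224 + 2 * x)) <=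
  NR 20000 * (\sum_(i < 110) g (256 * i.+1%:R + 144 + 16 * x) +
           6 * \sum_(i < 110) g (256 * i.+1%:R + 224 + 16 * x)).
Proof.
move=> /andP[x8 x16].
have [l l_in [t t01 ->]] : exists2 l : nat, l \in iota 8 8 &
    exists2 t : R, 0 <= t <= 1 & x = l%:R + t.
  have x0 : 0 <= x by lra.
  have /andP[lx xl] := truncn_itv x0.
  have l8 : (8 <= Num.truncn x)%N by rewrite truncn_ge_nat.
  have [l16|l16] := ltnP (Num.truncn x) 16.
    exists (Num.truncn x); first by rewrite mem_iota l8.
    by exists (x - (Num.truncn x)%:R); [rewrite -natr1 in xl; lra | rewrite subrKC].
  exists 15%N => //; exists 1; first by rewrite lexx ler01.
  rewrite natr1; apply/eqP; rewrite eq_le x16 /=; apply: le_trans lx.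
  by rewrite ler_nat.
by have /allP/(_ l l_in)/cell_okP/(_ t01) := cells_ok; rewrite NR_nat.
Qed.

Lemma slack_absorbs (u v p q p' q' s r s' r' : R) : 0 < u ->
  u * (p + 6 * q) <= v * (s + 6 * r) -> p' <= p -> q' <= q ->
  v / u * s <= s' -> v / u * r <= r' -> p' + 6 * q' <= s' + 6 * r'.
Proof.
move=> u0 key pp qq ss rr.
have : p + 6 * q <= v / u * (s + 6 * r) by rewrite mulrAC ler_pdivlMr // mulrC.
lra.
Qed.

(** All the arguments of the powers lie between 1 and M, so raising the exponent
    by eta costs a factor M^eta at most; eta is chosen to spend exactly the factor
    20001/20000. *)
Lemma key_inequality_perturbed : exists2 eta : R, 0 < eta &
  forall x : R, 8 <= x <= 16 ->
  (144 + 7 * x) `^ (- (31 / 20 + eta)) + 6 * (224 + 2 * x) `^ (- (31 / 20 + eta)) <=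
  \sum_(i < 110) ((256 * i.+1%:R + 144 + 16 * x) `^ (- (31 / 20 + eta)) +
                  6 * (256 * i.+1%:R + 224 + 16 * x) `^ (- (31 / 20 + eta))).
Proof.
pose M : R := 256 * 110 + 224 + 16 * 16.
have M1 : 1 < M by rewrite /M; lra.
pose u := NR 20001; pose v := NR 20000.
have u0 : 0 < u by exact: NR_gt0.
have v0 : 0 < v by exact: NR_gt0.
have uv : 1 < u / v.
  rewrite ltr_pdivlMr // mul1r /u -[20001%num]/(20000 + 1)%num NRD (NR_nat R 1).
  by rewrite ltrDl.
have L0 : 0 < ln M by exact: ln_gt0.
have l0 : 0 < ln (u / v) by exact: ln_gt0.
pose eta : R := ln (u / v) / ln M.
have eta0 : 0 < eta by exact: divr_gt0.
have M0 : 0 < M by exact: lt_trans M1.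
have split_exp (y : R) : 0 < y -> y `^ (- (31 / 20 + eta)) = g y * y `^ (- eta).
  by move=> y0; rewrite opprD powRD // (gt_eqF y0) implybT.
have lo (y : R) : 1 <= y -> y `^ (- (31 / 20 + eta)) <= g y.
  move=> y1; have y0 : 0 < y by exact: lt_le_trans y1.
  rewrite split_exp // ler_piMr ?powR_ge0 // powRN invf_le1 ?powR_gt0 //.
  by have := ler_powR y1 (ltW eta0); rewrite powRr0.
have hi (y : R) : 1 <= y <= M -> v / u * g y <= y `^ (- (31 / 20 + eta)).
  move=> /andP[y1 yM]; have y0 : 0 < y by exact: lt_le_trans y1.
  rewrite split_exp // mulrC ler_wpM2l ?powR_ge0 // powRN.
  rewrite -[v / u]invrK lef_pV2 ?posrE ?powR_gt0 ?invr_gt0 ?divr_gt0 // invf_div.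
  have <- : M `^ eta = u / v.
    by rewrite /powR gt_eqF // /eta divfK ?gt_eqF // lnK // posrE divr_gt0.
  by apply: ge0_ler_powR => //; rewrite ?nnegrE ?ltW.
exists eta => // x x8; have /andP[x8' x16] := x8.
rewrite big_split /= -mulr_sumr.
have sum_hi (k : R) : 0 <= k <= 224 ->
    v / u * \sum_(i < 110) g (256 * i.+1%:R + k + 16 * x) <=
    \sum_(i < 110) (256 * i.+1%:R + k + 16 * x) `^ (- (31 / 20 + eta)).
  move=> /andP[k0 k224]; rewrite mulr_sumr; apply: ler_sum => i _; apply: hi.
  have i1 : 1 <= i.+1%:R :> R by rewrite ler1n.
  have i110 : i.+1%:R <= 110 :> R by rewrite (ler_nat _ _ 110).
  rewrite /M; move: i1 i110; move: (i.+1%:R) => z z1 z110; clear -x8' x16 k0 k224 z1 z110.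
  by apply/andP; split; lra.
have key := key_inequality x8.
apply: slack_absorbs u0 key (lo _ _) (lo _ _) (sum_hi _ _) (sum_hi _ _); clear -x8' x16.
- lra.
- lra.
- by apply/andP; split; lra.
by apply/andP; split; lra.
Qed.
End KeyInequality.

(** * The dimension bound *)

Section Conclusion.
Variable R : realType.

(** The nodes 9 and 14 and the coefficients 1 and 6 were found numerically: near
    the exponent 31/20 this combination is close to the eigenfunction, for the
    leading eigenvalue, of the operator that sums a function of (q', q) over the
    110 children of (q', q). *)
Definition weight (p : R) (s : nat * nat) : R :=
  (9 * s.2%:R + 7 * s.1%:R) `^ (- p) + 6 * (14 * s.2%:R + 2 * s.1%:R) `^ (- p).

Lemma weight_ge0 p s : 0 <= weight p s.
Proof. by rewrite addr_ge0 ?mulr_ge0 ?powR_ge0. Qed.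

Lemma weight_le p s : 0 <= p -> (0 < s.2)%N -> weight p s <= 7 * s.2%:R `^ (- p).
Proof.
move=> p0 s0; have q0 : 0 < s.2%:R :> R by rewrite ltr0n.
have le_pow (y : R) : s.2%:R <= y -> y `^ (- p) <= s.2%:R `^ (- p).
  move=> qy; rewrite !powRN lef_pV2 ?posrE ?powR_gt0 ?(lt_le_trans q0) //.
  by apply: ge0_ler_powR; rewrite ?nnegrE ?(ltW q0) // (le_trans (ltW q0)).
have h (j k : R) : 1 <= j -> 0 <= k -> s.2%:R <= j * s.2%:R + k * s.1%:R.
  by move=> j1 k0; rewrite ler_wpDr ?mulr_ge0 // ler_peMl // ltW.
have h9 : (9 * s.2%:R + 7 * s.1%:R) `^ (- p) <= s.2%:R `^ (- p).
  by apply: le_pow; apply: h; rewrite ?ler1n.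
have h14 : (14 * s.2%:R + 2 * s.1%:R) `^ (- p) <= s.2%:R `^ (- p).
  by apply: le_pow; apply: h; rewrite ?ler1n.
rewrite /weight; clear -h9 h14; lra.
Qed.

(** The inequality is homogeneous in (q', q); dividing by (q / 16)^(-p) leaves
    the variable x = 16 q'/q, between 8 and 16. *)
Lemma weight_subharmonic (p : R) (s : nat * nat) :
  (forall x : R, 8 <= x <= 16 ->
     (144 + 7 * x) `^ (- p) + 6 * (224 + 2 * x) `^ (- p) <=
     \sum_(i < 110) ((256 * i.+1%:R + 144 + 16 * x) `^ (- p) +
                     6 * (256 * i.+1%:R + 224 + 16 * x) `^ (- p))) ->
  (0 < s.2)%N -> (s.1 <= s.2 <= s.1.*2)%N ->
  weight p s <= \sum_(i < 110) weight p (den_step s i.+1).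
Proof.
case: s => q' q /= key q0 /andP[q'q qq'].
have Q0 : 0 < q%:R :> R by rewrite ltr0n.
have Q'Q : q'%:R <= q%:R :> R by rewrite ler_nat.
have QQ' : q%:R <= 2 * q'%:R :> R by rewrite -natrM ler_nat mul2n.
pose c : R := 16 / q%:R.
have c0 : 0 < c by rewrite divr_gt0.
have scale (y z : R) : 0 <= y -> z = c * y -> z `^ (- p) = c `^ (- p) * y `^ (- p).
  by move=> y0 ->; rewrite powRM // ltW.
have lin_ge0 (j k : R) (m n : nat) : 0 <= j -> 0 <= k -> 0 <= j * m%:R + k * n%:R.
  by move=> j0 k0; rewrite addr_ge0 ?mulr_ge0.
pose x : R := 16 * q'%:R / q%:R.
have x_itv : 8 <= x <= 16.
  apply/andP; split; first by rewrite ler_pdivlMr //; clear -QQ'; lra.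
  by rewrite ler_pdivrMr //; clear -Q'Q; lra.
have qN0 : q%:R != 0 :> R by rewrite gt_eqF.
rewrite -(ler_pM2l (powR_gt0 (- p) c0)) mulr_sumr.
have E (t : nat * nat) (y z : R) :
    y = c * (9 * t.2%:R + 7 * t.1%:R) -> z = c * (14 * t.2%:R + 2 * t.1%:R) ->
    c `^ (- p) * weight p t = y `^ (- p) + 6 * z `^ (- p).
  move=> Ey Ez; rewrite (scale _ _ _ Ey) ?lin_ge0 // (scale _ _ _ Ez) ?lin_ge0 //.
  by rewrite /weight mulrDr mulrCA.
rewrite (E (q', q) (144 + 7 * x) (224 + 2 * x)).
- apply: le_trans (key _ x_itv) _; rewrite le_eqVlt; apply/orP; left; apply/eqP.
  apply: eq_bigr => i _; have D2 : (den_step (q', q) i.+1).2%:R =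
      q'%:R + (i.+1%:R + 1) * q%:R :> R by rewrite natr1 -natrM -natrD.
  have D1 : (den_step (q', q) i.+1).1%:R = q'%:R + i.+1%:R * q%:R :> R.
    by rewrite -natrM -natrD.
  by apply/esym/E; rewrite D1 D2 /c /x; field.
- by rewrite /c /x /=; field.
by rewrite /c /x /=; field.
Qed.

(** Stated for any set containing the Cantor set of A = 110, so that it applies to
    the union over all A as well. *)
Lemma hausdorff_dim_gt (E : set R) :
  (forall a : nat -> 'I_110, E (point R a)) ->
  ((775%:R / 1000%:R)%:E < hausdorff_dim E)%E.
Proof.
move=> Epoint; have [eta eta0 key] := key_inequality_perturbed R.
pose p := 31 / 20 + eta.
have p0 : 0 < p by rewrite addr_gt0 // divr_gt0.
apply: (@lt_le_trans _ _ (p / 2)%:E).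
  by rewrite lte_fin /p; clear -eta0; lra.
apply: le_ereal_inf_tmp => _ [s [s0 Hs0] <-]; rewrite lee_fin leNgt; apply/negP => sp.
pose phi (w : seq 'I_110) := weight p (den w).
have den0 (w : seq 'I_110) : (0 < (den w).2)%N.
  exact: leq_ltn_trans (size_lt_den w).
have phi_ge0 w : 0 <= phi w by exact: weight_ge0.
have phi_den w : phi w <= 7 * (den w).2%:R `^ (- p).
  by apply: weight_le => //; exact: ltW.
have phi_sub w : phi w <= \sum_(i : 'I_110) phi (rcons w i).
  under eq_bigr do rewrite /phi den_rcons.
  by apply: weight_subharmonic => //; exact: den_bounds.
have s_itv : 0 <= s <= p / 2 by rewrite s0 ltW.
have := hausdorff_measure_ge (ltn0Sn 109) p0 (ltr0n R 7) phi_ge0 phi_den phi_sub s_itv Epoint.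
rewrite Hs0 leNgt => /negP[].
rewrite lte_fin divr_gt0 ?mulr_gt0 ?powR_gt0 ?mulr_gt0 //.
by rewrite /phi /weight /= ltr_pwDl ?mulr_ge0 ?powR_ge0 // powR_gt0.
Qed.

Lemma point_frakC (A : nat) (a : nat -> 'I_A) : frakC R A (point R a).
Proof. by exists (fun i => (a i).+1) => // i /=. Qed.
End Conclusion.

Theorem theorem1p19 (R : realType) :
  ((775%:R / 1000%:R)%:E < vartheta_infty R)%E /\
  ((775%:R / 1000%:R)%:E < vartheta R 110)%E.
Proof.
split; apply: hausdorff_dim_gt => a; last exact: point_frakC.
by exists 110%N => //; exact: point_frakC.
Qed.
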